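(* Let $f:\mathbb{R}^n\to\mathbb{R}\cup\{\infty\}$ be convex and differentiable and let $X\subseteq\mathrm{dom}(f)$ be a nonempty polytope. Let $f^\star:=\min_{x\in X}f(x)$, $X^\star:=\{x\in X:f(x)=f^\star\}$, and suppose the map $x\mapsto\bar x:=\mathrm{argmin}_{y\in X^\star}\mathfrak{G}(y,x)$ is well defined for all $x\in X$. Suppose $L:=L_{f,X,\mathfrak{D}}<\infty$ and $\mu:=\max\{\mu^\star_{f,X,\mathfrak{G}},\ \mu^\sharp_{f,X,\mathfrak{G}}/4\}>0$. If the Frank-Wolfe with away steps algorithm described in the context is run with each stepsize chosen via \[ \alpha_k=\mathrm{argmin}_{\alpha\in[0,\alpha_{\max}]}\left\{f(x_k)+\alpha\langle\nabla f(x_k),v\rangle+\frac{L\alpha^2}{2}\right\}, \] then the iterates satisfy, for all $k=0,1,\dots$, \[ f(x_k)-f^\star\le\left(1-\min\left\{\frac12,\frac{\mu}{4L}\right\}\right)^{k/2}(f(x_0)-f^\star). \]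
   Context: Distances. $\mathfrak{D}:=\mathfrak{d}^2/2$ where $\mathfrak{d}:X\times X\to\mathbb{R}_+$ is the diametral distance \[ \mathfrak{d}(y,x):=\inf\{\delta>0:\ y-x=\delta\cdot(u-w)\text{ for some }u,w\in X\}. \] For $x\in X$ let $\mathbf{S}(x)$ be the collection of all subsets $S\subseteq\mathrm{vertices}(X)$ such that $x$ is a positive convex combination (all coefficients $>0$) of the elements of $S$. $\mathfrak{G}:=\mathfrak{g}^2/2$ where $\mathfrak{g}:X\times X\to\mathbb{R}_+$ is \[ \mathfrak{g}(y,x):=\inf\left\{\gamma>0:\ \langle\nabla f(x),x-y\rangle\le\gamma\cdot\min_{S\in\mathbf{S}(x)}\ \max_{a\in S,\,u\in X}\langle\nabla f(x),a-u\rangle\right\}. \] Constants. With $D_f(y,x)=f(y)-f(x)-\langle\nabla f(x),y-x\rangle$, \[ L_{f,X,\mathfrak{D}}:=\inf\{L>0:\ D_f(y,x)\le L\,\mathfrak{D}(y,x)\ \forall x,y\in X\}, \] \[ \mu^\star_{f,X,\mathfrak{G}}:=\sup\{\mu\ge0:\ D_f(\bar x,x)\ge\mu\,\mathfrak{G}(\bar x,x)\ \forall x\in X\}, \] \[ \mu^\sharp_{f,X,\mathfrak{G}}:=\sup\{\mu\ge0:\ f(x)-f^\star\ge\mu\,\mathfrak{G}(\bar x,x)\ \forall x\in X\}. \] The point $\bar x$ is a minimizer of $\mathfrak{G}(\cdot,x)$ over $X^\star$ (a fixed choice of one if it is not unique). Convention: $\mu/(4L)=+\infty$ if $L=0$ or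 $\mu=+\infty$. Algorithm (Frank-Wolfe with away steps). Each iterate $x$ carries a vertex representation: a set $S(x)\subseteq\mathrm{vertices}(X)$ and weights $\lambda_s(x)>0$, $s\in S(x)$, summing to $1$, with $x=\sum_{s\in S(x)}\lambda_s(x)s$. Start with $x_0\in\mathrm{vertices}(X)$, $S(x_0)=\{x_0\}$, $\lambda_{x_0}(x_0)=1$. For $k=0,1,2,\dots$: 1. Let $u\in\mathrm{argmin}_{y\in X}\langle\nabla f(x_k),y\rangle$ be a vertex of $X$ and let $a\in\mathrm{argmax}_{y\in S(x_k)}\langle\nabla f(x_k),y\rangle$. 2. If $\langle\nabla f(x_k),u-x_k\rangle<\langle\nabla f(x_k),x_k-a\rangle$ (regular step), set $v:=u-x_k$, $\alpha_{\max}:=1$. Otherwise (away step) set $v:=x_k-a$, $\alpha_{\max}:=\frac{\lambda_a(x_k)}{1-\lambda_a(x_k)}$ (read as $+\infty$ if $\lambda_a(x_k)=1$, in which case $v=0$ and $x_{k+1}=x_k$). 3. Set $x_{k+1}:=x_k+\alpha_kv$ with $\alpha_k\in[0,\alpha_{\max}]$. 4. Update the representation: in a regular step the new weights are $(1-\alpha_k)\lambda_s(x_k)$ for $s\in S(x_k)\setminus\{u\}$ and $(1-\alpha_k)\lambda_u(x_k)+\alpha_k$ for $u$ (with $\lambda_u(x_k)=0$ if $u\notin S(x_k)$); in an away step they are $(1+\alpha_k)\lambda_s(x_k)$ for $s\in S(x_k)\setminus\{a\}$ and $(1+\alpha_k)\lambda_a(x_k)-\alpha_k$ for $a$ (when $v=0$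 the representation is unchanged); $S(x_{k+1})$ is the set of vertices with positive weight. (Optionally, this representation may be replaced by another valid one with no more vertices.) *)

(* Defs.v *)
From HB Require Import structures.
From mathcomp Require Import all_boot all_order all_algebra finmap.
From mathcomp Require Import all_classical all_reals all_analysis.

Set Implicit Arguments.
Unset Strict Implicit.
Unset Printing Implicit Defensive.

Import Order.TTheory GRing.Theory Num.Theory.
Import numFieldNormedType.Exports.

Local Open Scope classical_set_scope.
Local Open Scope ring_scope.

Section Optimizers.
Context {disp : Order.disp_t} {T : Type} {D : porderType disp}.

Definition argmin (A : set T) (phi : T -> D) : set T :=
  [set x | A x /\ forall y, A y -> (phi x <= phi y)%O].

Definition argmax (A : set T) (phi : T -> D) : set T :=
  [set x | A x /\ forall y, A y -> (phi y <= phi x)%O].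

End Optimizers.

Section FrankWolfe.
Context {R : realType} {n : nat}.
Local Notation V := 'rV[R]_n.

Implicit Types (f : V -> \bar R) (X : set V) (x y u a s : V).

Definition dot x y : R := \sum_(i < n) x 0 i * y 0 i.

Definition dom f : set V := [set x | (f x < +oo)%E].

(* Functions into R \cup {+oo} are maps into [\bar R] avoiding -oo. *)
Definition no_ninfty f := forall x, f x != -oo%E.

Definition econvex f := forall x y (t : R), 0 <= t <= 1 ->
  (f (t *: x + (1 - t) *: y)%R <= t%:E * f x + (1 - t)%:E * f y)%E.

(* An extended-valued function is differentiable at x only if it is finite
   around x; [fine] then recovers its real values near x.  In particular the
   domain of a function that is differentiable on its domain is open. *)
Definition differentiable_on_dom f := forall x, dom f x ->
  (\forall y \near x, dom f y) /\ differentiable (fine \o f) x.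

Definition grad f x : V := \row_(i < n) 'D_(delta_mx 0 i) (fine \o f) x.

Definition polytope X := exists (m : nat) (p : 'I_m -> V),
  X = [set x | exists w : 'I_m -> R,
         [/\ forall i, 0 <= w i, \sum_i w i = 1 & x = \sum_i w i *: p i]].

(* The vertices of a polytope are its extreme points. *)
Definition vertices X : set V :=
  [set x | X x /\ forall y z (t : R), X y -> X z -> 0 < t < 1 ->
             x = t *: y + (1 - t) *: z -> y = x /\ z = x].

(* Weights on points, with zero weight outside a finite set; a representation
   (S, lambda) is encoded by lambda alone, with S := finsupp lambda. *)
Definition weights : Type := {fsfun V -> R with 0}.

Definition vertex_rep X x (lam : weights) :=
  [/\ forall s, s \in finsupp lam -> vertices X s /\ 0 < lam s,
      \sum_(s <- finsupp lam) lam s = 1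
    & x = \sum_(s <- finsupp lam) lam s *: s].

Definition supports X x : set {fset V} :=
  [set S | exists lam, vertex_rep X x lam /\ finsupp lam = S].

Definition diam_dist X y x : R :=
  inf [set delta : R | 0 < delta /\
         exists u w, [/\ X u, X w & y - x = delta *: (u - w)]].

Definition DD X y x : R := diam_dist X y x ^+ 2 / 2.

(* For a polytope X and x in X there are finitely many supports (and at least
   one), and X is compact, so the infimum and the supremum are attained. *)
Definition minmax f X x : R :=
  inf [set sup [set r : R | exists a u,
                  [/\ a \in S, X u & r = dot (grad f x) (a - u)]]
      | S in supports X x].

Definition grad_dist f X y x : R :=
  inf [set gamma : R | 0 < gamma /\
         dot (grad f x) (x - y) <= gamma * minmax f X x].

Definition GG f X y x : R := grad_dist f X y x ^+ 2 / 2.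

Definition bregman f y x : \bar R :=
  (f y - f x - (dot (grad f x) (y - x))%:E)%E.

Definition L_const f X : \bar R :=
  ereal_inf [set L%:E | L in [set L : R | 0 < L /\
    forall x y, X x -> X y -> (bregman f y x <= (L * DD X y x)%:E)%E]].

Definition fmin f X : \bar R := ereal_inf (f @` X).

Definition minimizers f X : set V := [set x | X x /\ f x = fmin f X].

Definition mu_star f X (xbar : V -> V) : \bar R :=
  ereal_sup [set mu%:E | mu in [set mu : R | 0 <= mu /\
    forall x, X x ->
      ((mu * GG f X (xbar x) x)%:E <= bregman f (xbar x) x)%E]].

Definition mu_sharp f X (xbar : V -> V) : \bar R :=
  ereal_sup [set mu%:E | mu in [set mu : R | 0 <= mu /\
    forall x, X x ->
      ((mu * GG f X (xbar x) x)%:E <= f x - fmin f X)%E]].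

(* mu / (4 L), with value +oo when L = 0 or mu = +oo. *)
Definition cond_ratio (mu : \bar R) (L : R) : \bar R :=
  if (L == 0) || (mu == +oo%E) then +oo%E else (fine mu / (4 * L))%:E.

Definition fw_contraction (mu : \bar R) (L : R) : R :=
  fine (mine (2^-1)%:E (cond_ratio mu L)).

Definition regular f x u a : bool :=
  dot (grad f x) (u - x) < dot (grad f x) (x - a).

Definition direction f x u a : V :=
  if regular f x u a then u - x else x - a.

Definition alpha_max f x (lam : weights) u a : \bar R :=
  if regular f x u a then 1%:E
  else if lam a == 1 then +oo%E else (lam a / (1 - lam a))%:E.

Definition admissible f x (lam : weights) u a : set R :=
  [set alpha | 0 <= alpha /\ (alpha%:E <= alpha_max f x lam u a)%E].

Definition updated_weight f x (lam : weights) u a (alpha : R) s : R :=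
  if direction f x u a == 0 then lam s
  else if regular f x u a then
    (1 - alpha) * lam s + (if s == u then alpha else 0)
  else (1 + alpha) * lam s - (if s == a then alpha else 0).

(* The last alternative is the optional replacement of the updated
   representation by another one with no more vertices. *)
Definition fw_away_step f X x (lam : weights) u a (alpha : R)
    x' (lam' : weights) :=
  [/\ vertices X u /\ argmin X (dot (grad f x)) u,
      argmax [set s | s \in finsupp lam] (dot (grad f x)) a,
      admissible f x lam u a alpha,
      x' = x + alpha *: direction f x u a
    & exists lam1 : weights,
        (forall s, lam1 s = updated_weight f x lam u a alpha s) /\
        (lam' = lam1 \/
         vertex_rep X x' lam' /\
         (#|` finsupp lam' | <= #|` finsupp lam1 |)%N)].

Definition fw_away_run f X (x : nat -> V) (lam : nat -> weights)
    (u a : nat -> V) (alpha : nat -> R) :=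
  [/\ vertices X (x 0%N),
      forall s, lam 0%N s = (if s == x 0%N then 1 else 0)
    & forall k, fw_away_step f X (x k) (lam k) (u k) (a k) (alpha k)
                  (x k.+1) (lam k.+1)].

Definition model f (L : R) x v (alpha : R) : \bar R :=
  (f x + (alpha * dot (grad f x) v + L * alpha ^+ 2 / 2)%:E)%E.

End FrankWolfe.

(* Main.v *)
(* Write h = f(x_k) - f^*, let g be the gradient at x_k, v the direction of the
   step, p = <g, -v> and A = <g, a - u>, so that p >= A / 2 and p >= h.  The
   min-max in the definition of the distance is at most A on the current
   support, whence <g, x_k - xbar> <= grad_dist * A; combined with either growth
   condition this gives 2 mu h <= A^2.  The definition of L bounds f(x_{k+1}) by
   the quadratic model, whose unconstrained minimum decreases f by p^2 / (2L) >=
   mu h / (4L).  A regular step truncated at 1 decreases f by at least p / 2 >=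
   h / 2.  A truncated away step does not increase f and removes a vertex from
   the support; as only the other steps can enlarge the support, by one vertex
   at most, at least half of the first k steps contract h. *)

Require Import Defs.
From HB Require Import structures.
From mathcomp Require Import all_boot all_order all_algebra finmap.
From mathcomp Require Import all_classical all_reals all_analysis.
From mathcomp Require Import ring lra zify.

Set Implicit Arguments.
Unset Strict Implicit.
Unset Printing Implicit Defensive.

Import Order.TTheory GRing.Theory Num.Theory.
Import numFieldNormedType.Exports.

Local Open Scope classical_set_scope.
Local Open Scope ring_scope.

(** * Linearity of the pairing in its second argument *)

Section Dot.
Context {R : realType} {n : nat}.
Implicit Types g y z : 'rV[R]_n.

Lemma dotDr g y z : dot g (y + z) = dot g y + dot g z.
Proof. by rewrite -big_split; apply: eq_bigr => i _; rewrite mxE mulrDr. Qed.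

Lemma dotZr g c y : dot g (c *: y) = c * dot g y.
Proof. by rewrite mulr_sumr; apply: eq_bigr => i _; rewrite mxE mulrCA. Qed.

Lemma dotNr g y : dot g (- y) = - dot g y.
Proof. by rewrite -scaleN1r dotZr mulN1r. Qed.

Lemma dotBr g y z : dot g (y - z) = dot g y - dot g z.
Proof. by rewrite dotDr dotNr. Qed.

Lemma dot0r g : dot g 0 = 0.
Proof. by rewrite -(scale0r g) dotZr mul0r. Qed.

Lemma dot_sumr g (I : Type) (r : seq I) (F : I -> 'rV[R]_n) :
  dot g (\sum_(i <- r) F i) = \sum_(i <- r) dot g (F i).
Proof. by apply: (big_morph (dot g)); [exact: dotDr | exact: dot0r]. Qed.

End Dot.

(** * Convex combinations in a polytope and vertex representations *)

Section Polytope.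
Context {R : realType} {n : nat}.
Implicit Types (X : set 'rV[R]_n) (g x : 'rV[R]_n) (lam : @weights R n).

(** Substituting the barycentric coordinates of each point into the combination gives coordinates in
    the generators [p]. *)
Lemma polytope_convex X (r : seq 'rV[R]_n) (w : 'rV[R]_n -> R) :
    polytope X -> (forall s, s \in r -> X s /\ 0 <= w s) ->
  \sum_(s <- r) w s = 1 -> X (\sum_(s <- r) w s *: s).
Proof.
move=> [m [p ->]] Xr sum_w.
have /choice[c cP] : forall s, exists c : 'I_m -> R, s \in r ->
    [/\ forall i, 0 <= c i, \sum_i c i = 1 & s = \sum_i c i *: p i].
  move=> s; have [/Xr[[c cP] _]|_] := boolP (s \in r); first by exists c.
  by exists (fun=> 0).
exists (fun i => \sum_(s <- r) w s * c s i); split.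
- move=> i; rewrite big_seq; apply: sumr_ge0 => s sr.
  by apply: mulr_ge0; [have [] := Xr s sr | have [] := cP s sr].
- rewrite exchange_big /= -sum_w !big_seq; apply: eq_bigr => s sr.
  by have [_ c1 _] := cP s sr; rewrite -mulr_sumr c1 mulr1.
- under [RHS]eq_bigr do rewrite scaler_suml.
  rewrite exchange_big /= !big_seq; apply: eq_bigr => s sr.
  have [_ _ sE] := cP s sr; rewrite [X in _ *: X = _]sE scaler_sumr.
  by apply: eq_bigr => i _; rewrite scalerA.
Qed.

Lemma polytope_dot_bounded X g : polytope X ->
  exists B : R, forall x, X x -> `|dot g x| <= B.
Proof.
move=> [m [p ->]]; exists (\sum_i `|dot g (p i)|) => _ [w [w0 w1 ->]].
rewrite dot_sumr (le_trans (ler_norm_sum _ _ _))//; apply: ler_sum => i _.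
rewrite dotZr normrM ler_piMl// ger0_norm// -w1 (bigD1 i)//= lerDl.
by apply: sumr_ge0.
Qed.

(** Lets sums over the supports of two different weight functions run over one common index set. *)
Lemma finsupp_sum lam (A : {fset 'rV[R]_n}) (U : nmodType)
    (F : R -> 'rV[R]_n -> U) :
  (finsupp lam `<=` A)%fset -> (forall s, F 0 s = 0) ->
  \sum_(s <- finsupp lam) F (lam s) s = \sum_(s <- A) F (lam s) s.
Proof.
move=> sub F0; apply: big_fset_incl => // s _ sN.
by rewrite fsfun_dflt.
Qed.

Lemma vertex_rep_mem X x lam : polytope X -> vertex_rep X x lam -> X x.
Proof.
move=> pX [pos sum1 ->]; apply: polytope_convex => // s /pos[[Xs _] /ltW].
by [].
Qed.

(** The weighted mean over the support of the gaps [dot g x - dot g s] is zero, so these gaps cannot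
    all be positive. *)
Lemma vertex_rep_max_ge X g x lam : vertex_rep X x lam ->
  exists2 s, s \in finsupp lam & dot g x <= dot g s.
Proof.
move=> [pos sum1 xE]; apply: contrapT => nex.
have lt s : s \in finsupp lam -> dot g s < dot g x.
  by move=> sl; rewrite ltNge; apply/negP => le; apply: nex; exists s.
have [s0 s0l] : exists s, s \in finsupp lam.
  apply: contrapT => no; move: sum1; rewrite big_seq big1 => [|s sl].
    by move/eqP; rewrite eq_sym oner_eq0.
  by exfalso; apply: no; exists s.
have : 0 < \sum_(s <- finsupp lam) lam s * (dot g x - dot g s).
  rewrite (big_fsetD1 s0)//= ltr_wpDr//.
    rewrite big_seq; apply: sumr_ge0 => s; rewrite in_fsetD1 => /andP[_ sl].
    by rewrite mulr_ge0 ?subr_ge0 ?ltW ?lt//; have [] := pos s sl.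
  by rewrite mulr_gt0 ?subr_gt0 ?lt//; have [] := pos s0 s0l.
under eq_bigr => s do rewrite mulrBr -(dotZr g _ s).
by rewrite sumrB -mulr_suml sum1 mul1r -dot_sumr -xE subrr ltxx.
Qed.

End Polytope.

(** * First-order inequality for extended-valued convex functions *)

Section Convex.
Context {R : realType} {n : nat}.
Variable f : 'rV[R]_n -> \bar R.
Hypotheses (f_no_ninfty : no_ninfty f) (f_convex : econvex f)
  (f_diff : differentiable_on_dom f).

Lemma dom_fin_num y : dom f y -> f y \is a fin_num.
Proof. by move=> fy; rewrite fin_numE f_no_ninfty -ltey. Qed.

Lemma derive_grad x v : dom f x -> 'D_v (fine \o f) x = dot (grad f x) v.
Proof.
move=> /f_diff[_ df]; rewrite deriveE// [X in 'd _ _ X]row_sum_delta linear_sum/=.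
apply: eq_bigr => i _; rewrite linearZ/= mxE deriveE//.
by rewrite mulrC.
Qed.

(** The difference quotients along [y - x] converge to the left side as [t] decreases to 0. Were it
    larger than the right side, the quotient at some [t] in (0, 1) would be too, against
    convexity. *)
Lemma gradient_inequality x y : dom f x -> dom f y ->
  dot (grad f x) (y - x) <= fine (f y) - fine (f x).
Proof.
move=> fx fy; have [_ df] := f_diff fx.
rewrite -derive_grad//; set v := y - x.
have dv : derivable (fine \o f) x v by exact: diff_derivable.
rewrite leNgt; apply/negP => lt.
have near_lt := cvgr_gt _ (cvg_dnbhs_at_right dv) _ lt.
have : \forall t \near (0 : R)^'+, False; last by move/filter_const.
near=> t.
have t0 : 0 < t by near: t; exact: nbhs_right_gt.
have t1 : t < 1 by near: t; exact: nbhs_right_lt.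
have : fine (f y) - fine (f x) <
     t^-1 * (fine (f (t *: v + x)) - fine (f x)) by near: t; exact: near_lt.
apply/negP; rewrite -leNgt ler_pdivrMl// mulrBr.
have t01 : 0 <= t <= 1 by rewrite !ltW.
have := f_convex y x t01.
have -> : t *: y + (1 - t) *: x = t *: v + x.
  by rewrite scalerBl scale1r scalerBr [x - _]addrC addrA.
rewrite -(fineK (dom_fin_num fx)) -(fineK (dom_fin_num fy)) -!EFinM -EFinD.
have := f_no_ninfty (t *: v + x).
by case: (f _) => //= r _; rewrite lee_fin; lra.
Unshelve. all: by end_near. Qed.
End Convex.

(** * The two distances, the min-max and the smoothness constant *)

Section Distances.
Context {R : realType} {n : nat}.
Implicit Types (f : 'rV[R]_n -> \bar R) (X : set 'rV[R]_n).
Implicit Types (x y u a : 'rV[R]_n) (lam : @weights R n).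

Lemma diam_dist_ge0 X x y : 0 <= diam_dist X y x.
Proof.
rewrite /diam_dist; set D := (X in inf X).
have [->|D0] := eqVneq D set0; first by rewrite inf0.
by apply: lb_le_inf => [|d [/ltW//]]; exact/set0P.
Qed.

(** A positive [t] itself competes in the infimum. For [t = 0], which the definition excludes, every
    [e > 0] competes through the zero difference [u - u]. *)
Lemma diam_dist_le X x u a (t : R) : X u -> X a -> 0 <= t ->
  diam_dist X (x + t *: (u - a)) x <= t.
Proof.
move=> Xu Xa t0; apply/ler_addgt0Pr => e e0.
rewrite /diam_dist; set D := (X in inf X).
have lb : has_lbound D by exists 0 => d [/ltW].
have [t_eq0|t_neq0] := eqVneq t 0.
  rewrite t_eq0 add0r; apply: ge_inf => //; split=> //.
  by exists u, u; split=> //; rewrite t_eq0 scale0r addr0 !subrr scaler0.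
apply: (@le_trans _ _ t); last by rewrite lerDl ltW.
apply: ge_inf => //; split; first by rewrite lt0r t_neq0.
by exists u, a; split=> //; rewrite addrAC subrr add0r.
Qed.

Lemma grad_dist_ge0 f X x y : 0 <= grad_dist f X y x.
Proof.
rewrite /grad_dist; set D := (X in inf X).
have [->|D0] := eqVneq D set0; first by rewrite inf0.
by apply: lb_le_inf => [|d [/ltW//]]; exact/set0P.
Qed.

(** Some support point [s] satisfies [dot g x <= dot g s] for the gradient [g], and the pair [s],
    [y] competes in the supremum. Boundedness of linear forms on the polytope makes this a genuine
    supremum rather than a default value. *)
Lemma support_gap_ge f X x y S : polytope X -> supports X x S -> X y ->
  dot (grad f x) (x - y) <= sup [set r : R | exists a u,
    [/\ a \in S, X u & r = dot (grad f x) (a - u)]].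
Proof.
move=> pX [lam [rep <-]] Xy.
have [s sl le] := vertex_rep_max_ge (grad f x) rep.
have [B BP] := polytope_dot_bounded (grad f x) pX.
have ub : has_ubound [set r : R | exists a u,
    [/\ a \in finsupp lam, X u & r = dot (grad f x) (a - u)]].
  exists (B + B) => _ [a [u [al Xu ->]]].
  have [pos _ _] := rep; have [[Xa _] _] := pos a al.
  have := BP _ Xa; have := BP _ Xu; rewrite !ler_norml dotBr; lra.
apply: (@le_trans _ _ (dot (grad f x) (s - y))); first by rewrite !dotBr lerD2r.
by apply: ub_le_sup => //; exists s, y.
Qed.

Lemma minmax_ge f X x y lam : polytope X -> vertex_rep X x lam -> X y ->
  dot (grad f x) (x - y) <= minmax f X x.
Proof.
move=> pX rep Xy; apply: lb_le_inf.
  by eexists; exists (finsupp lam) => //; exists lam.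
by move=> _ [S SP <-]; exact: support_gap_ge.
Qed.

Lemma minmax_le f X x lam u a : polytope X -> vertex_rep X x lam ->
  argmin X (dot (grad f x)) u ->
  argmax [set s | s \in finsupp lam] (dot (grad f x)) a ->
  minmax f X x <= dot (grad f x) (a - u).
Proof.
move=> pX rep [Xu minu] [al maxa]; 
apply: (@le_trans _ _ (sup [set r : R | exists s w,
    [/\ s \in finsupp lam, X w & r = dot (grad f x) (s - w)]])).
- apply: ge_inf; last by exists (finsupp lam) => //; exists lam.
  (* The infimum is genuine: taking [y := x] in [support_gap_ge] bounds every supremum below by
     0. *)
  exists 0 => _ [S SP <-]; rewrite -(dot0r (grad f x)) -(subrr x).
  exact/support_gap_ge/(vertex_rep_mem pX rep).
- apply: ge_sup; first by exists (dot (grad f x) (a - u)); exists a, u.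
  move=> _ [s [w [sl Xw ->]]]; rewrite !dotBr lerB//.
    exact: maxa.
  exact: minu.
Qed.

(** After division by a positive min-max, the quotient lies below every competing [gamma], hence
    below their infimum. If the min-max is 0, [minmax_ge] already makes the left side
    nonpositive. *)
Lemma grad_dist_minmax f X x y lam : polytope X -> vertex_rep X x lam -> X y ->
  dot (grad f x) (x - y) <= grad_dist f X y x * minmax f X x.
Proof.
move=> pX rep Xy; have le := minmax_ge f pX rep Xy.
have : 0 <= minmax f X x.
  rewrite -(dot0r (grad f x)) -(subrr x).
  exact: (minmax_ge f pX rep (vertex_rep_mem pX rep)).
rewrite le0r => /predU1P[m0|m_gt0]; first by move: le; rewrite m0 mulr0.
rewrite -ler_pdivrMr//; apply: lb_le_inf.
  (* A competing [gamma] has to be exhibited, since the infimum of the empty set is 0 by default;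
     adding 1 keeps it positive. *)
  exists (`|dot (grad f x) (x - y)| / minmax f X x + 1); split.
    by rewrite ltr_wpDl// divr_ge0// ltW.
  by rewrite mulrDl mul1r divfK ?gt_eqF// (le_trans (ler_norm _))// lerDl ltW.
by move=> g [_]; rewrite -ler_pdivrMr.
Qed.

Lemma L_constP f X (L : R) x y : no_ninfty f -> X `<=` dom f ->
    L_const f X = L%:E -> X x -> X y ->
  fine (f y) - fine (f x) - dot (grad f x) (y - x) <= L * DD X y x.
Proof.
move=> fN Xf LE Xx Xy; rewrite leNgt; apply/negP => lt.
set D := DD X y x in lt *; set b := (X in _ < X) in lt.
have D0 : 0 <= D by rewrite divr_ge0// sqr_ge0.
(* With this [e] one has [(L + e) * D = b - e < b], while some [L' < L + e] satisfies the defining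
   inequality. This handles the infimum without assuming that it is attained. *)
pose e := (b - L * D) / (D + 1).
have e0 : 0 < e by rewrite divr_gt0 ?subr_gt0// ltr_wpDl.
have : (L_const f X < (L + e)%:E)%E by rewrite LE lte_fin ltrDl.
move=> /ereal_inf_lt[_ [L' [L'0 /(_ x y Xx Xy) le] <-]]; rewrite lte_fin => L'lt.
move: le; rewrite /bregman -/D -(fineK (dom_fin_num fN (Xf _ Xx))).
rewrite -(fineK (dom_fin_num fN (Xf _ Xy))) -!EFinB lee_fin -/b.
apply/negP; rewrite -ltNge.
apply: (@le_lt_trans _ _ ((L + e) * D)); first by rewrite ler_wpM2r// ltW.
have : e * (D + 1) = b - L * D by rewrite divfK// gt_eqF// ltr_wpDl.
nra.
Qed.

Lemma L_const_ge0 f X (L : R) : L_const f X = L%:E -> 0 <= L.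
Proof.
move=> LE; rewrite -lee_fin -LE; apply: le_ereal_inf_tmp.
by move=> _ [L' [/ltW L'0 _] <-].
Qed.

(** The direction is a difference of points of [X], so the diametral distance travelled is at most
    [alpha] and [DD] is at most [alpha ^+ 2 / 2]. *)
Lemma L_const_descent f X (L : R) x u a (alpha : R) : no_ninfty f ->
    X `<=` dom f -> L_const f X = L%:E -> X x -> X u -> X a -> 0 <= alpha ->
    X (x + alpha *: (u - a)) ->
  fine (f (x + alpha *: (u - a))) <=
    fine (f x) + alpha * dot (grad f x) (u - a) + L * alpha ^+ 2 / 2.
Proof.
move=> fN Xf LE Xx Xu Xa alpha0 Xy.
have := L_constP fN Xf LE Xx Xy.
rewrite [_ + _ - x]addrAC subrr add0r dotZr.
have : L * DD X (x + alpha *: (u - a)) x <= L * (alpha ^+ 2 / 2).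
  rewrite ler_wpM2l ?(L_const_ge0 LE)// ler_wpM2r//.
  by rewrite lerXn2r ?nnegrE ?diam_dist_ge0// diam_dist_le.
lra.
Qed.

(** * Error bounds derived from the two growth conditions *)

Section ErrorBound.
Variables (f : 'rV[R]_n -> \bar R) (X : set 'rV[R]_n).
Hypotheses (f_no_ninfty : no_ninfty f) (f_convex : econvex f)
  (f_diff : differentiable_on_dom f) (X_polytope : polytope X)
  (X_dom : X `<=` dom f).
Variables (x y u a : 'rV[R]_n) (lam : @weights R n).
Hypotheses (rep : vertex_rep X x lam) (Xy : X y)
  (fy_min : fine (f y) <= fine (f x)) (u_min : argmin X (dot (grad f x)) u)
  (a_max : argmax [set s | s \in finsupp lam] (dot (grad f x)) a).

Let h := fine (f x) - fine (f y).
Let A := dot (grad f x) (a - u).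
Let d := grad_dist f X y x.

Let Xx : X x. Proof. exact: vertex_rep_mem rep. Qed.

Let fw_gap : dot (grad f x) (x - y) <= d * A.
Proof.
apply: le_trans (grad_dist_minmax f X_polytope rep Xy) _.
apply: ler_wpM2l; first exact: grad_dist_ge0.
exact: minmax_le X_polytope rep u_min a_max.
Qed.

(** The hypothesis gives [h <= d * A - m * d ^+ 2 / 2]. Multiplying by [2 * m] and completing the
    square bounds [2 * m * h] by [A ^+ 2 - (A - m * d) ^+ 2]. *)
Lemma error_bound_star (m : R) : 0 <= m -> ((m * GG f X y x)%:E <= bregman f y x)%E ->
  2 * m * h <= A ^+ 2.
Proof.
move=> m0; rewrite /bregman -(fineK (dom_fin_num f_no_ninfty (X_dom Xx))).
rewrite -(fineK (dom_fin_num f_no_ninfty (X_dom Xy))) -!EFinB lee_fin /GG -/d.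
have := fw_gap; rewrite !dotBr /h => gap le.
have : 0 <= (A - m * d) ^+ 2 by exact: sqr_ge0.
nra.
Qed.

(** Convexity gives [h <= d * A], and growth gives [m * d ^+ 2 / 2 <= h]. Hence [m * h ^+ 2 <= m * d
    ^+ 2 * A ^+ 2 <= 2 * h * A ^+ 2], and [h] cancels. The loss against the other bound is the
    factor 4 in [mu]. *)
Lemma error_bound_sharp (m : R) : 0 <= m -> f y = fmin f X ->
  ((m * GG f X y x)%:E <= f x - fmin f X)%E -> m * h <= 2 * A ^+ 2.
Proof.
move=> m0 <-; rewrite -(fineK (dom_fin_num f_no_ninfty (X_dom Xx))).
rewrite -(fineK (dom_fin_num f_no_ninfty (X_dom Xy))) -!EFinB lee_fin /GG -/d -/h.
have h0 : 0 <= h by rewrite subr_ge0.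
have hd : h <= d * A.
  apply: le_trans fw_gap.
  have := gradient_inequality f_no_ninfty f_convex f_diff (X_dom Xx) (X_dom Xy).
  rewrite !dotBr /h; lra.
move: h0; rewrite le0r => /predU1P[->|h_gt0] le; first by rewrite mulr0 mulr_ge0 ?sqr_ge0.
have h2 : h ^+ 2 <= (d * A) ^+ 2 by rewrite lerXn2r ?nnegrE ?(le_trans _ hd)// ltW.
rewrite -(ler_pM2r h_gt0).
have : m * h ^+ 2 <= m * (d * A) ^+ 2 by rewrite ler_wpM2l.
have : m * (d ^+ 2 / 2) * A ^+ 2 <= h * A ^+ 2 by rewrite ler_wpM2r// sqr_ge0.
rewrite exprMn; lra.
Qed.

End ErrorBound.
End Distances.

(** * Effect of a step on the vertex representation *)

Section Reweight.
Context {R : realType} {n : nat}.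
Variables (X : set 'rV[R]_n) (x : 'rV[R]_n) (lam : @weights R n).
Hypothesis rep : vertex_rep X x lam.

Lemma vertex_rep_weight_le1 s : lam s <= 1.
Proof.
have [pos <- _] := rep; have [sl|sN] := boolP (s \in finsupp lam).
  rewrite (big_fsetD1 s)//= lerDl big_seq; apply: sumr_ge0 => r.
  by rewrite in_fsetD1 => /andP[_ /pos[_ /ltW]].
by rewrite fsfun_dflt// big_seq; apply: sumr_ge0 => r /pos[_ /ltW].
Qed.

Lemma vertex_rep_weight1 s : lam s = 1 -> x = s.
Proof.
move=> lam_s1; have [pos sum1 ->] := rep.
have sl : s \in finsupp lam by rewrite mem_finsupp lam_s1 oner_eq0.
suff S0 : (finsupp lam `\ s)%fset = fset0.
  by rewrite (big_fsetD1 s)//= S0 big_seq_fset0 addr0 lam_s1 scale1r.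
apply/fsetP => r; rewrite in_fset0; apply/negP => rl.
move: sum1; rewrite (big_fsetD1 s)//= (big_fsetD1 r)//= lam_s1.
have lam_r : 0 < lam r by move: rl; rewrite in_fsetD1 => /andP[_ /pos[]].
have : 0 <= \sum_(i <- ((finsupp lam `\ s) `\ r)%fset) lam i.
  rewrite big_seq; apply: sumr_ge0 => i.
  by rewrite !in_fsetD1 => /and3P[_ _ /pos[_ /ltW]].
lra.
Qed.

Lemma vertex_rep_card_gt0 : (0 < #|` finsupp lam|)%N.
Proof.
have [s sl _] := vertex_rep_max_ge 0 rep.
by rewrite cardfs_gt0; apply/fset0Pn; exists s.
Qed.

(** One formula covers all updates: [e = u], [b = alpha] for a regular step, [e = a], [b = - alpha]
    for an away step, and [b = 0] for a null direction. *)
Lemma reweight_rep e (b : R) (lam1 : @weights R n) : vertices X e ->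
    (forall s, lam1 s = (1 - b) * lam s + (if s == e then b else 0)) ->
    (forall s, 0 <= lam1 s) ->
  vertex_rep X (x + b *: (e - x)) lam1 /\
  (finsupp lam1 `<=` e |` finsupp lam)%fset.
Proof.
move=> Ve lam1E lam1_ge0; have [pos sum1 xE] := rep.
have sub1 : (finsupp lam1 `<=` e |` finsupp lam)%fset.
  apply/fsubsetP => s; rewrite in_fset1U !mem_finsupp lam1E.
  have [//|_] := eqVneq s e; rewrite /= addr0; apply: contra_neq => ->.
  by rewrite mulr0.
have sub : (finsupp lam `<=` e |` finsupp lam)%fset by exact: fsubsetUr.
have eA : e \in (e |` finsupp lam)%fset by rewrite in_fset1U eqxx.
split=> //; split.
- move=> s sl1; split; last first.
    by rewrite lt0r lam1_ge0 andbT -mem_finsupp.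
  by have := fsubsetP sub1 s sl1; rewrite in_fset1U => /predU1P[->//|/pos[]].
- rewrite (finsupp_sum (F := fun w _ => w) sub1)//.
  under eq_bigr do rewrite lam1E.
  rewrite big_split/= -mulr_sumr -(finsupp_sum (F := fun w _ => w) sub)// sum1.
  rewrite (big_fsetD1 e)//= eqxx big_seq big1 => [|s]; first by ring.
  by rewrite in_fsetD1 => /andP[/negPf ->].
- rewrite (finsupp_sum (F := fun w s => w *: s) sub1); last by move=> s; rewrite scale0r.
  under eq_bigr do rewrite lam1E scalerDl -scalerA.
  rewrite big_split/= -scaler_sumr.
  rewrite -(finsupp_sum (F := fun w s => w *: s) sub); last by move=> s; rewrite scale0r.
  rewrite -xE (big_fsetD1 e)//= eqxx big_seq big1 => [|s].
    by rewrite addr0 scalerBl scale1r scalerBr [b *: e - _]addrC addrA.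
  by rewrite in_fsetD1 => /andP[/negPf ->]; rewrite scale0r.
Qed.

Variables (f : 'rV[R]_n -> \bar R) (u a : 'rV[R]_n) (alpha : R).
Variable lam1 : @weights R n.
Hypotheses (Vu : vertices X u) (al : a \in finsupp lam).
Hypothesis alpha_adm : admissible f x lam u a alpha.
Hypothesis lam1E : forall s, lam1 s = updated_weight f x lam u a alpha s.

Let lam_ge0 s : 0 <= lam s.
Proof.
have [pos _ _] := rep; have [/pos[_ /ltW//]|sN] := boolP (s \in finsupp lam).
by rewrite fsfun_dflt.
Qed.

Lemma away_weight_lt1 : ~~ regular f x u a -> direction f x u a != 0 ->
  lam a < 1.
Proof.
rewrite /direction => /negPf -> d_neq0.
rewrite lt_neqAle vertex_rep_weight_le1 andbT; apply: contra_neq d_neq0.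
by move/vertex_rep_weight1 => ->; rewrite subrr.
Qed.

Lemma updated_rep :
  [/\ vertex_rep X (x + alpha *: direction f x u a) lam1,
      (#|` finsupp lam1| <= #|` finsupp lam| + regular f x u a)%N &
      ~~ regular f x u a -> direction f x u a != 0 ->
        alpha = lam a / (1 - lam a) -> (#|` finsupp lam1| < #|` finsupp lam|)%N].
Proof.
have [pos _ _] := rep; have [[Va _] [alpha0 alpha_le]] := (pos a al, alpha_adm).
have aS : (a |` finsupp lam)%fset = finsupp lam.
  by apply/fsetUidPr; rewrite fsub1set.
have [d0|d_neq0] := eqVneq (direction f x u a) 0.
  have lam1E0 s : lam1 s = (1 - 0) * lam s + (if s == a then 0 else 0).
    by rewrite lam1E /updated_weight d0 eqxx subr0 mul1r if_same addr0.
  have lam1_ge0 s : 0 <= lam1 s by rewrite lam1E0 subr0 mul1r if_same addr0.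
  have [rep1 sub] := reweight_rep Va lam1E0 lam1_ge0.
  split=> //; first by rewrite d0 scaler0 addr0; move: rep1; rewrite scale0r addr0.
  by rewrite (leq_trans (fsubset_leq_card sub))// aS leq_addr.
move: alpha_le d_neq0 lam1E (away_weight_lt1); rewrite /alpha_max /updated_weight /direction.
case: ifPn => [reg|nreg] alpha_le /negPf d_neq0 E lam_a; rewrite ?d_neq0 in E *.
  have lam1_ge0 s : 0 <= lam1 s.
    rewrite E addr_ge0//; last by case: ifP.
    by rewrite mulr_ge0// subr_ge0 -lee_fin.
  have [rep1 sub] := reweight_rep Vu E lam1_ge0.
  split=> //; rewrite (leq_trans (fsubset_leq_card sub))// cardfsU1 addnC leq_add2l.
  exact: leq_b1.
have {}lam_a : lam a < 1 by apply: lam_a => //; rewrite d_neq0.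
have E' s : lam1 s = (1 - - alpha) * lam s + (if s == a then - alpha else 0).
  by rewrite E opprK; case: ifP => _ //; rewrite subr0 addr0.
have lam1_ge0 s : 0 <= lam1 s.
  rewrite E; case: eqP => [->|_]; last by rewrite subr0 mulr_ge0// addr_ge0.
  (* The new weight of [a] is nonnegative exactly when [alpha <= lam a / (1 - lam a)]. *)
  move: alpha_le; rewrite lt_eqF// lee_fin ler_pdivlMr ?subr_gt0//; lra.
have [rep1 sub] := reweight_rep Va E' lam1_ge0.
rewrite aS in sub; split.
- by move: rep1; rewrite scaleNr -scalerN opprB.
- by rewrite addn0 fsubset_leq_card.
(* At the maximal step the weight of [a] vanishes, and no other vertex has entered. *)
- move=> _ _ alphaE; rewrite [X in (_ < X)%N](cardfsD1 a) al add1n ltnS.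
  apply: fsubset_leq_card; apply/fsubsetP => s sl1.
  rewrite in_fsetD1 (fsubsetP sub)// andbT; apply: contraTneq sl1 => ->.
  rewrite mem_finsupp negbK E eqxx alphaE; apply/eqP; field.
  by rewrite subr_eq0 gt_eqF.
Qed.

End Reweight.

(** * Progress made by a single step *)

Section Step.
Context {R : realType} {n : nat}.
Variables (f : 'rV[R]_n -> \bar R) (X : set 'rV[R]_n) (L : R).
Hypotheses (f_no_ninfty : no_ninfty f) (f_convex : econvex f)
  (f_diff : differentiable_on_dom f) (X_polytope : polytope X)
  (X_dom : X `<=` dom f) (L_def : L_const f X = L%:E).

(** The rate [c] is kept abstract: [c <= 2^-1] serves the truncated regular step, and the bound with
    factor 8 serves the untruncated steps. *)
Lemma away_step_progress x y (lam lam' : @weights R n) u a alpha x' c :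
    vertex_rep X x lam -> X y -> fine (f y) <= fine (f x) ->
    fw_away_step f X x lam u a alpha x' lam' ->
    argmin (admissible f x lam u a) (model f L x (direction f x u a)) alpha ->
    0 <= c <= 2^-1 ->
    8 * L * c * (fine (f x) - fine (f y)) <= dot (grad f x) (a - u) ^+ 2 ->
  vertex_rep X x' lam' /\
  ((fine (f x') - fine (f y) <= (1 - c) * (fine (f x) - fine (f y)) /\
    (#|` finsupp lam'| <= #|` finsupp lam|.+1)%N) \/
   (fine (f x') - fine (f y) <= fine (f x) - fine (f y) /\
    (#|` finsupp lam'| < #|` finsupp lam|)%N)).
Proof.
move=> rep Xy fyx [[Vu u_min] a_max adm x'E [lam1 [lam1E lam'E]]] [_ alpha_min].
move=> /andP[c0 c2] bound; have [al maxa] := a_max; have [Xu minu] := u_min.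
have Xx := vertex_rep_mem X_polytope rep.
have Xa : X a by have [pos _ _] := rep; have [[]] := pos a al.
have [rep1 card1 drop1] := updated_rep rep Vu al adm lam1E.
set d := direction f x u a in x'E rep1 drop1 alpha_min.
have {lam'E lam1E} [rep' card'] :
    vertex_rep X x' lam' /\ (#|` finsupp lam'| <= #|` finsupp lam1|)%N.
  by case: lam'E => [->|[]//]; rewrite x'E.
split=> //.
set h := fine (f x) - fine (f y) in fyx bound *.
have h_ge0 : 0 <= h by rewrite subr_ge0.
pose p := - dot (grad f x) d.
pose q (b : R) := L * b ^+ 2 / 2 - b * p.
have L0 : 0 <= L by exact: L_const_ge0 L_def.
have gax : 0 <= dot (grad f x) (a - x).
  have [s sl le] := vertex_rep_max_ge (grad f x) rep.
  by rewrite dotBr subr_ge0 (le_trans le)//; exact: maxa.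
have gxu : h <= dot (grad f x) (x - u).
  have := gradient_inequality f_no_ninfty f_convex f_diff (X_dom Xx) (X_dom Xy).
  by have := minu y Xy; rewrite !dotBr /h; lra.
(* By the choice of direction, [p] is the larger of the gaps at [u] and at [a], whose sum is
   [dot (grad f x) (a - u)]. *)
have pE : p = if regular f x u a then dot (grad f x) (x - u)
              else dot (grad f x) (a - x).
  by rewrite /p /d /direction; case: ifP => _; rewrite -dotNr opprB.
have hp : h <= p.
  rewrite pE; case: ifPn => //; rewrite /regular -leNgt.
  by move: gxu; rewrite !dotBr; lra.
have Ap : 0 <= dot (grad f x) (a - u) <= 2 * p.
  move: gax gxu; rewrite pE /regular.
  by case: ifPn; rewrite -?leNgt !dotBr; lra.
have p_reg : regular f x u a -> 0 < p.
  move=> reg; rewrite pE reg; move: reg gax; rewrite /regular !dotBr; lra.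
have q_min b : admissible f x lam u a b -> q alpha <= q b.
  move=> /alpha_min; rewrite /model -(fineK (dom_fin_num f_no_ninfty (X_dom Xx))).
  by rewrite -!EFinD lee_fin /q /p; lra.
(* Smoothness bounds the new value by the model at [alpha], which is at most the model at any
   admissible [b]. *)
have descent b : admissible f x lam u a b -> fine (f x') - fine (f y) <= h + q b.
  move=> /q_min; have Xx' := vertex_rep_mem X_polytope rep1.
  have [alpha0 _] := adm.
  suff : fine (f x') <= fine (f x) + alpha * dot (grad f x) d + L * alpha ^+ 2 / 2.
    by rewrite /q /p /h; lra.
  by move: Xx'; rewrite x'E /d /direction; case: ifP => _;
    exact: L_const_descent.
have adm0 : admissible f x lam u a 0.
  split=> //; apply: le_trans (proj2 adm); rewrite lee_fin.
  by have [] := adm.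
(* [p / L] is the unconstrained minimizer of the quadratic model. *)
have full_step : 0 < L -> admissible f x lam u a (p / L) ->
    fine (f x') - fine (f y) <= (1 - c) * h.
  move=> L_gt0 /descent; have -> : q (p / L) = - (p ^+ 2 / (2 * L)).
    by rewrite /q; field; rewrite gt_eqF.
  (* Since [dot (grad f x) (a - u) <= 2 * p], the hypothesis gives [8 * L * c * h <= 4 * p ^+ 2]. *)
  suff : c * h <= p ^+ 2 / (2 * L) by lra.
  rewrite ler_pdivlMr ?mulr_gt0//; nra.
have stalled : p <= 0 -> fine (f x') - fine (f y) <= (1 - c) * h.
  have := descent 0 adm0; rewrite /q => le p0.
  have h0 : h = 0 by apply/eqP; rewrite eq_le h_ge0 (le_trans hp).
  by rewrite h0 in le *; lra.
have card_good : (#|` finsupp lam'| <= #|` finsupp lam|.+1)%N.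
  rewrite (leq_trans card')// (leq_trans card1)// -[leqRHS]addn1 leq_add2l.
  exact: leq_b1.
have [p0|p0] := leP p 0; first by left; split=> //; exact: stalled.
have [reg|nreg] := boolP (regular f x u a).
  left; split=> //; have [pL|Lp] := leP p L.
    have L_gt0 := lt_le_trans p0 pL.
    apply: full_step => //; split; first by rewrite divr_ge0// ltW.
    by rewrite /alpha_max reg lee_fin ler_pdivrMr// mul1r.
  (* Here [q 1 = L / 2 - p < - p / 2], which is at most [- c * h]. *)
  have /descent : admissible f x lam u a 1 by split=> //; rewrite /alpha_max reg.
  by rewrite /q; nra.
have d_neq0 : d != 0 by apply: contra_ltN p0 => /eqP d0; rewrite /p d0 dot0r oppr0.
have lam_a := away_weight_lt1 rep nreg d_neq0.
have lam_a0 : 0 < lam a by have [pos _ _] := rep; have [] := pos a al.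
pose am := lam a / (1 - lam a).
have am0 : 0 < am by rewrite divr_gt0// subr_gt0.
have amE : alpha_max f x lam u a = am%:E by rewrite /alpha_max (negPf nreg) lt_eqF.
(* Multiplying out [p / L <= am] also covers [L = 0], which then falls into the truncated case. *)
have [pL|Lp] := leP p (L * am).
  have L_gt0 : 0 < L by rewrite lt0r L0 andbT; apply: contraTneq pL => ->; rewrite mul0r -ltNge.
  left; split=> //; apply: full_step => //; split; first by rewrite divr_ge0// ltW.
  by rewrite amE lee_fin ler_pdivrMr// mulrC.
right; split; first by apply: le_trans (descent 0 adm0) _; rewrite /q; lra.
apply: leq_ltn_trans card' (drop1 nreg d_neq0 _).
have [alpha0 ] := adm; rewrite amE lee_fin le_eqVlt => /predU1P[//|lt].
have /q_min : admissible f x lam u a am by split; [exact: ltW | rewrite amE].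
(* The model strictly decreases on [0, am], so its minimizer is [am]: the
   vertex [a] leaves the support. *)
suff : 0 < q alpha - q am by lra.
have -> : q alpha - q am = (am - alpha) * (p - L * (am + alpha) / 2).
  by rewrite /q; field.
rewrite mulr_gt0 ?subr_gt0//; nra.
Qed.

End Step.

(** * Assembly: the contraction constant and the count of contracting steps *)

Theorem proposition9 (R : realType) (n : nat)
    (f : 'rV[R]_n -> \bar R) (X : set 'rV[R]_n)
    (xbar : 'rV[R]_n -> 'rV[R]_n) (L : R) (mu : \bar R)
    (x : nat -> 'rV[R]_n) (lam : nat -> @weights R n)
    (u a : nat -> 'rV[R]_n) (alpha : nat -> R)
    (f_no_ninfty : no_ninfty f)
    (f_convex : econvex f)
    (f_diff : differentiable_on_dom f)
    (X_polytope : polytope X)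
    (X_nonempty : X !=set0)
    (X_dom : X `<=` dom f)
    (xbarP : forall z, X z ->
      argmin (minimizers f X) (fun y => GG f X y z) (xbar z))
    (L_def : L_const f X = L%:E)
    (mu_def : mu = maxe (mu_star f X xbar) (mu_sharp f X xbar * (4^-1)%:E)%E)
    (mu_gt0 : (0 < mu)%E)
    (run : fw_away_run f X x lam u a alpha)
    (stepsize : forall k,
      argmin (admissible f (x k) (lam k) (u k) (a k))
             (model f L (x k) (direction f (x k) (u k) (a k))) (alpha k)) :
  forall k : nat,
    (f (x k) - fmin f X <=
      ((1 - fw_contraction mu L) `^ (k%:R / 2))%:E * (f (x 0%N) - fmin f X))%E.
Proof.
have [Vx0 lam0 step] := run; have [Xx0 _] := Vx0.
have [[Xy fy] _] := xbarP _ Xx0; set y := xbar (x 0%N) in Xy fy.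
have ffin z : X z -> f z = (fine (f z))%:E.
  by move=> Xz; rewrite fineK//; apply: dom_fin_num => //; exact: X_dom.
have fle z : X z -> fine (f y) <= fine (f z).
  move=> Xz; rewrite -lee_fin -!ffin// fy; apply: ereal_inf_lbound.
  by exists z.
(* Stated for [c] strictly below [mu], because [mu] is built from suprema that may be infinite or
   not attained. *)
have error_bound z l u' a' (c : R) : vertex_rep X z l ->
    argmin X (dot (grad f z)) u' ->
    argmax [set s | s \in finsupp l] (dot (grad f z)) a' ->
    (c%:E < mu)%E ->
    2 * c * (fine (f z) - fine (f y)) <= dot (grad f z) (a' - u') ^+ 2.
  move=> rep u_min a_max; have Xz := vertex_rep_mem X_polytope rep.
  have [[Xyz fyz] _] := xbarP _ Xz.
  have fyyz : fine (f y) = fine (f (xbar z)) by rewrite fy fyz.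
  have h0 : 0 <= fine (f z) - fine (f y) by rewrite subr_ge0 fle.
  rewrite mu_def lt_max => /orP[|].
    move=> /ereal_sup_gt[_ [m [m0 mP] <-]]; rewrite lte_fin => cm.
    rewrite fyyz in h0 *.
    have := error_bound_star f_no_ninfty X_polytope X_dom rep Xyz u_min a_max m0
      (mP _ Xz); nra.
  rewrite lte_pdivlMr// -EFinM => /ereal_sup_gt[_ [m [m0 mP] <-]].
  rewrite lte_fin => cm; rewrite fyyz in h0 *.
  have := error_bound_sharp f_no_ninfty f_convex f_diff X_polytope X_dom rep Xyz
    _ u_min a_max m0 fyz (mP _ Xz).
  rewrite -subr_ge0 => /(_ h0); nra.
set c := fw_contraction mu L.
have [c01 cP] : 0 <= c <= 2^-1 /\ forall h A : R, 0 <= h ->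
    (forall c' : R, (c'%:E < mu)%E -> 2 * c' * h <= A ^+ 2) ->
    8 * L * c * h <= A ^+ 2.
  have L0 : 0 <= L := L_const_ge0 L_def.
  rewrite /c /fw_contraction /cond_ratio; case: ifPn => [L_mu|].
    rewrite min_l ?leey//=; split=> [|h A h0 muP]; first lra.
    move: L_mu => /orP[/eqP->|/eqP mu_oo]; first by rewrite mulr0 !mul0r sqr_ge0.
    (* For infinite [mu] the rate is 1/2, and [8 * L / 2 = 2 * (2 * L)] dictates this choice. *)
    have := muP (2 * L); rewrite mu_oo ltry => /(_ isT); lra.
  rewrite negb_or => /andP[L_neq0 mu_noo].
  have L_gt0 : 0 < L by rewrite lt0r L_neq0.
  move: mu mu_gt0 mu_noo {mu_def error_bound c} => [m| |]//; rewrite lte_fin => m0 _.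
  rewrite /= -EFin_min/=; split=> [|h A].
    by rewrite le_min ge_min lexx/= andbT invr_ge0 ler0n/= divr_ge0 ?mulr_ge0// ltW.
  rewrite le0r => /predU1P[->|h_gt0] muP; first by rewrite mulr0 sqr_ge0.
  have mA : 2 * m * h <= A ^+ 2.
    rewrite leNgt; apply/negP => lt.
    have lt_m : A ^+ 2 / (2 * h) < m.
      by rewrite ltr_pdivrMr ?mulr_gt0// mulrCA mulrA.
    (* The midpoint between [A ^+ 2 / (2 * h)] and [m] lies below [m] and violates the bound. *)
    have := muP ((A ^+ 2 / (2 * h) + m) / 2).
    rewrite lte_fin => /(_ ltac:(lra)).
    have -> : 2 * ((A ^+ 2 / (2 * h) + m) / 2) * h = A ^+ 2 / 2 + m * h.
      by field; rewrite gt_eqF.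
    lra.
  apply: le_trans mA; rewrite ler_pM2r//.
  have : Order.min 2^-1 (m / (4 * L)) <= m / (4 * L) by rewrite ge_min lexx orbT.
  by rewrite ler_pdivlMr ?mulr_gt0//; lra.
have [c0 c2] := andP c01.
(* [N] counts contracting steps. Such a step raises [k + #|S|] by at most 2, a dropping step does
   not raise it, and it starts at 1; with a nonempty support this yields [k <= N.*2]. *)
have inv k : vertex_rep X (x k) (lam k) /\
    exists2 N, (k + #|` finsupp (lam k)| <= N.*2.+1)%N &
      fine (f (x k)) - fine (f y) <=
        (1 - c) ^+ N * (fine (f (x 0%N)) - fine (f y)).
  elim: k => [|k [rep [N le_N le_h]]].
    have supp0 : finsupp (lam 0%N) = [fset (x 0%N)]%fset.
      apply/fsetP => s; rewrite mem_finsupp lam0 in_fset1.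
      by case: (s == x 0%N); rewrite ?oner_eq0 ?eqxx.
    split; last by exists 0%N; rewrite ?supp0 ?cardfs1 ?expr0 ?mul1r.
    split; rewrite supp0 ?big_seq_fset1 ?lam0 ?eqxx ?scale1r// => s.
    by rewrite in_fset1 => /eqP->; rewrite lam0 eqxx.
  have Xxk := vertex_rep_mem X_polytope rep.
  have [[_ u_min] a_max _ _ _] := step k.
  have bound := cP _ (dot (grad f (x k)) (a k - u k)) _
    (fun c' => error_bound _ _ _ _ c' rep u_min a_max).
  have [rep' prog] := away_step_progress f_no_ninfty f_convex f_diff X_polytope
    X_dom L_def rep Xy (fle _ Xxk) (step k) (stepsize k) c01
    (bound ltac:(by rewrite subr_ge0 fle)).
  split=> //; case: prog => -[le_h' le_card].
    exists N.+1; last first.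
      by rewrite exprS -mulrA (le_trans le_h')// ler_wpM2l//; lra.
    by rewrite doubleS addSn -addnS; lia.
  exists N; last exact: le_trans le_h.
  by rewrite addSn -addnS (leq_trans _ le_N)// leq_add2l.
move=> k; have [rep [N le_N le_h]] := inv k.
have Xxk := vertex_rep_mem X_polytope rep.
rewrite -fy (ffin _ Xxk) (ffin _ Xx0) (ffin _ Xy) -!EFinB -EFinM lee_fin.
apply: le_trans le_h _; rewrite ler_wpM2r ?subr_ge0 ?fle//.
have k_le : (k <= N.*2)%N by have := vertex_rep_card_gt0 rep; lia.
rewrite -powR_mulrn; last by lra.
(* The base lies in [1/2, 1], so lowering the exponent from [N] to [k / 2] can only increase the
   power. *)
apply: ger_powR; first by apply/andP; split; lra.
by rewrite ler_pdivrMr// -natrM ler_nat muln2.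
Qed.
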